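(* Let $(F^m,g_F)$ have constant sectional curvature $\kappa$, let $m\ge2$, and consider a smooth metric $$g=dt^2+f(t)^2g_F,\qquad f>0,$$ on $J\times F$, where $J\subset\mathbb R$ is an open interval. Suppose a connected nonflat definite Ricci phase $I\subset J$ has exact pinching $\delta_{\mathrm{Ric}}\equiv1/C$, with $C\ge m$, and that a point $t_0\in\overline I\cap J$ is Ricci-flat. Then such a phase cannot meet $t_0$: the warping function $f$ is affine, and the metric is Ricci-flat, on a one-sided neighborhood of $t_0$ contained in $I$ (so no such $I$ and $t_0$ exist).
   Context: A connected nonflat definite Ricci phase is a nonempty open interval $I\subset J$ such that the Ricci tensor of $g$ is definite (everywhere positive definite, or everywhere negative definite) on $I\times F$. At a non-Ricci-flat point with Ricci eigenvalues $\lambda_i$ (relative to $g$), $\delta_{\mathrm{Ric}}=\min_i|\lambda_i|/\max_i|\lambda_i|$. ''$t_0$ is Ricci-flat'' means $\operatorname{Ric}=0$ along $\{t_0\}\times F$. The Ricci eigenvalues of $g$ are $\lambda_0=-m f''/f$ (multiplicity $1$) and $\lambda_F=-f''/f+(m-1)(\kappa-(f')^2)/f^2$ (multiplicity $m$). *)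

(* Defs.v *)
From HB Require Import structures.
From mathcomp Require Import all_boot all_order all_algebra.
From mathcomp Require Import all_classical all_reals all_analysis.
Import Order.TTheory GRing.Theory Num.Theory.
Import numFieldNormedType.Exports.

Set Implicit Arguments.
Unset Strict Implicit.
Unset Printing Implicit Defensive.

Local Open Scope classical_set_scope.
Local Open Scope ring_scope.

Section LocalGeometry.
Context {R : realType} {n : nat}.
Implicit Types (h : 'rV[R]_n -> R) (g : 'rV[R]_n -> 'M[R]_n) (x u v : 'rV[R]_n).

Definition basis_vec (i : 'I_n) : 'rV[R]_n := delta_mx 0 i.

Definition partial (i : 'I_n) h : 'rV[R]_n -> R :=
  fun x => 'D_(basis_vec i) h x.

Definition smooth_on (U : set 'rV[R]_n) h : Prop :=
  forall (s : seq 'I_n) x, U x ->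
    {for x, continuous (foldr partial h s)} /\
    (forall i, derivable (foldr partial h s) x (basis_vec i)).

Definition posdef (M : 'M[R]_n) : Prop :=
  forall v, v != 0 -> 0 < (v *m M *m v^T) 0 0.

Definition negdef (M : 'M[R]_n) : Prop := posdef (- M).

(* Vectors are row vectors, so the scalar product of u and v at x is
   u *m g x *m v^T. *)
Definition inner g x u v : R := (u *m g x *m v^T) 0 0.

(* Gamma^l_{ij} *)
Definition christoffel g (l i j : 'I_n) x : R :=
  2^-1 * \sum_(s < n) invmx (g x) l s *
    (partial i (fun y => g y j s) x + partial j (fun y => g y i s) x
     - partial s (fun y => g y i j) x).

(* R^l_{ijk}, with R(d_i, d_j) d_k = \sum_l R^l_{ijk} d_l and
   R(X, Y) Z = nabla_X nabla_Y Z - nabla_Y nabla_X Z - nabla_[X, Y] Z. *)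
Definition riemann g (l i j k : 'I_n) x : R :=
  partial i (christoffel g l j k) x - partial j (christoffel g l i k) x
  + \sum_(s < n) (christoffel g l i s x * christoffel g s j k x
                  - christoffel g l j s x * christoffel g s i k x).

(* R(u, v) w *)
Definition curvature g x u v (w : 'rV[R]_n) : 'rV[R]_n :=
  \row_l \sum_i \sum_j \sum_k u 0 i * v 0 j * w 0 k * riemann g l i j k x.

Definition sectional g x u v : R :=
  inner g x (curvature g x u v v) u
  / (inner g x u u * inner g x v v - inner g x u v ^+ 2).

(* Ric(Y, Z) is the trace of X |-> R(X, Y) Z. *)
Definition ricci g x : 'M[R]_n :=
  \matrix_(j, k) \sum_i riemann g i i j k x.

(* Matrix, acting on row vectors, of the Ricci endomorphism: l is an
   eigenvalue with eigenvector v iff Ric(v, -) = l * g(v, -). *)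
Definition ricci_endo g x : 'M[R]_n := ricci g x *m invmx (g x).

End LocalGeometry.

(* The data of an n-dimensional Riemannian manifold, given by an atlas of charts
   together with the matrix of the metric in each of them. The carrier is a
   subset of T. All functions are total: coord i is relevant only on dom i;
   param i (the inverse chart) and metric i only on coord i @` dom i. *)
Record atlas (R : realType) (T : topologicalType) (n : nat) := Atlas {
  index : Type;
  dom : index -> set T;
  coord : index -> T -> 'rV[R]_n;
  param : index -> 'rV[R]_n -> T;
  metric : index -> 'rV[R]_n -> 'M[R]_n
}.

Section Manifold.
Context {R : realType} {T : topologicalType} {n : nat}.
Variable A : atlas R T n.

Definition transition (i j : index A) (x : 'rV[R]_n) : 'rV[R]_n :=
  coord j (param i x).

Definition overlap (i j : index A) : set 'rV[R]_n :=
  coord i @` (dom i `&` dom j).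

Definition transition_jacobian (i j : index A) (x : 'rV[R]_n) : 'M[R]_n :=
  \matrix_(k, l) partial k (fun y => transition i j y 0 l) x.

(* A is a smooth Riemannian manifold with underlying space the whole of T. *)
Record riemannian_manifold : Prop := {
  rm_hausdorff : hausdorff_space T;
  rm_second_countable : @second_countable T;
  rm_nonempty : [set: T] !=set0;
  rm_cover : forall p : T, exists i : index A, dom i p;
  rm_open_dom : forall i : index A, open (dom i);
  rm_open_image : forall i : index A, open (coord i @` dom i);
  rm_coordK : forall (i : index A) p, dom i p -> param i (coord i p) = p;
  rm_coord_continuous : forall i : index A,
    {within dom i, continuous (coord i)};
  rm_param_continuous : forall i : index A,
    {within coord i @` dom i, continuous (param i)};
  rm_transition_smooth : forall (i j : index A) (l : 'I_n),
    smooth_on (overlap i j) (fun y => transition i j y 0 l);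
  rm_metric_smooth : forall (i : index A) (k l : 'I_n),
    smooth_on (coord i @` dom i) (fun y => metric i y k l);
  rm_metric_sym : forall (i : index A) x, (coord i @` dom i) x ->
    (metric i x)^T = metric i x;
  rm_metric_posdef : forall (i : index A) x, (coord i @` dom i) x ->
    posdef (metric i x);
  rm_metric_compat : forall (i j : index A) x, overlap i j x ->
    metric i x = transition_jacobian i j x *m metric j (transition i j x)
                 *m (transition_jacobian i j x)^T
}.

Definition constant_sectional_curvature (kappa : R) : Prop :=
  forall (i : index A) (p : T) (u v : 'rV[R]_n),
    dom i p -> row_free (col_mx u v) ->
    sectional (metric i) (coord i p) u v = kappa.

Definition ricci_flat_on (S : set T) : Prop :=
  forall (i : index A) p, S p -> dom i p -> ricci (metric i) (coord i p) = 0.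

Definition ricci_posdef_on (S : set T) : Prop :=
  forall (i : index A) p, S p -> dom i p ->
    posdef (ricci (metric i) (coord i p)).

Definition ricci_negdef_on (S : set T) : Prop :=
  forall (i : index A) p, S p -> dom i p ->
    negdef (ricci (metric i) (coord i p)).

Definition ricci_eigenvalues (p : T) : set R :=
  [set l | exists2 i : index A,
             dom i p & eigenvalue (ricci_endo (metric i) (coord i p)) l].

(* The set of eigenvalues is finite and nonempty (the Ricci endomorphism is
   self-adjoint), so that inf and sup are min and max. *)
Definition ricci_pinching (p : T) : R :=
  inf [set `|l| | l in ricci_eigenvalues p]
  / sup [set `|l| | l in ricci_eigenvalues p].

End Manifold.

Section WarpedProduct.
Context {R : realType} {F : topologicalType} {m : nat}.

(* J x F with the metric dt^2 + f(t)^2 g_F, in the product charts (t, x). *)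
Definition warped_product (J : set R) (f : R -> R) (A : atlas R F m) :
    atlas R (R * F)%type (1 + m) :=
  @Atlas R (R * F)%type (1 + m) (index A)
    (fun i => J `*` dom i)
    (fun i p => row_mx p.1%:M (coord i p.2))
    (fun i y => (y 0 0, param i (rsubmx y)))
    (fun i y => block_mx 1%:M 0 0 ((f (y 0 0)) ^+ 2 *: metric i (rsubmx y))).

Definition open_interval (I : set R) : Prop :=
  [/\ I !=set0, open I & is_interval I].

Definition smooth_fun_on (J : set R) (f : R -> R) : Prop :=
  forall (k : nat) t, J t -> derivable (derive1n k f) t 1.

(* Nonflatness of a definite Ricci phase is implied by definiteness of Ric. *)
Definition definite_ricci_phase (J : set R) (f : R -> R) (A : atlas R F m)
    (I : set R) : Prop :=
  let W := warped_product J f A in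
  [/\ open_interval I, I `<=` J &
      ricci_posdef_on W (I `*` setT) \/ ricci_negdef_on W (I `*` setT)].

Definition has_exact_pinching (J : set R) (f : R -> R) (A : atlas R F m)
    (I : set R) (d : R) : Prop :=
  forall p, (I `*` setT) p -> ricci_pinching (warped_product J f A) p = d.

Definition ricci_flat_at (J : set R) (f : R -> R) (A : atlas R F m)
    (t0 : R) : Prop :=
  ricci_flat_on (warped_product J f A) ([set t0] `*` setT).

Definition one_sided_nbhd (t0 : R) (N : set R) : Prop :=
  exists2 e : R, 0 < e & N = `]t0, t0 + e[%classic \/ N = `]t0 - e, t0[%classic.

Definition affine_on (N : set R) (f : R -> R) : Prop :=
  exists a b : R, forall t, N t -> f t = a * t + b.

End WarpedProduct.

(* Main.v *)
(* On a fiber chart the warped metric has Ric(d_t, d_t) = -m f''/f, no mixed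
   terms Ric(d_t, -), and fiber block
   Ric_F - (f f'' + (m - 1) f'^2) g_F, where constant curvature gives
   Ric_F(u, u) = kappa (m - 1) g_F(u, u) by tracing the Jacobi operator. Hence
   every Ricci eigenvalue is lambda_0 or lambda_F, and exact pinching 1/C < 1
   means that one of them is C times the other. Which one is constant along the
   phase, since lambda_F - lambda_0 does not vanish there. With
   w = kappa - f'^2 the two cases read f f'' = c w for a constant c (or w = 0
   identically when lambda_0 = m lambda_F, so that f' is constant). In the former
   case f^(2c) w is constant on the phase and vanishes at the Ricci-flat point
   t_0, so w = 0. Either way f'' = 0, contradicting definiteness. *)
Require Import Defs.
From HB Require Import structures.
From mathcomp Require Import all_boot all_order all_algebra.
From mathcomp Require Import all_classical all_reals all_analysis.
From mathcomp Require Import ring lra.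
Import Order.TTheory GRing.Theory Num.Theory.
Import numFieldNormedType.Exports.
Local Open Scope classical_set_scope.
Local Open Scope ring_scope.

(** * Christoffel symbols and Ricci tensor of a warped metric *)

Lemma partial_cst {R : realType} {n : nat} (i : 'I_n) (c : R) x :
  partial i (fun=> c) x = 0.
Proof. exact: derive_cst. Qed.

Section WarpedCurvature.
Context {R : realType} {m : nat}.
Variables (J : set R) (f : R -> R) (U : set 'rV[R]_m) (h : 'rV[R]_m -> 'M[R]_m).
Hypothesis Jopen : open J.
Hypothesis Uopen : open U.
Hypothesis fsmooth : smooth_fun_on J f.
Hypothesis fpos : forall t, J t -> 0 < f t.
Hypothesis hder : forall a b c x, U x ->
  derivable (fun y => h y a b) x (basis_vec c : 'rV[R]_m).
Hypothesis hsym : forall x, U x -> (h x)^T = h x.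
Hypothesis hunit : forall x, U x -> h x \in unitmx.

(** Convertible to the [metric] field of [warped_product] in a chart whose fiber metric is [h], and
    [warped_point] likewise to its [coord], so the formulas below apply to the atlas directly. *)
Definition warped_metric (y : 'rV[R]_(1 + m)) : 'M[R]_(1 + m) :=
  block_mx 1%:M 0 0 ((f (y 0 0)) ^+ 2 *: h (rsubmx y)).

Definition warped_point (t : R) (x : 'rV[R]_m) : 'rV[R]_(1 + m) :=
  row_mx t%:M x.

Local Notation g := warped_metric.
Local Notation pt := warped_point.
Local Notation o := (lshift m (0 : 'I_1)).
Local Notation r := (rshift 1).

Lemma warped_point_base t x : pt t x 0 0 = t.
Proof.
have -> : (0 : 'I_(1 + m)) = o by exact: val_inj.
by rewrite /warped_point row_mxEl mxE.
Qed.

Lemma warped_point_fiber t x : rsubmx (pt t x) = x.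
Proof. exact: row_mxKr. Qed.

(** Stepping along a fiber basis vector leaves the base coordinate fixed, so the two difference
    quotients are the same function. *)
Lemma partial_fiber (H : 'rV[R]_(1 + m) -> R) t x a :
  partial (r a) H (pt t x) = partial a (fun y => H (pt t y)) x.
Proof.
rewrite /partial /derive; set d := (fun _ : R => _); set d' := (fun _ : R => _).
suff -> : d = d' by [].
apply: funext => s; rewrite /d /d' /=.
congr (_ *: (H _ - _)).
by rewrite /basis_vec delta_mx_rshift /warped_point scale_row_mx scaler0 add_row_mx add0r.
Qed.

Lemma partial_base (H : 'rV[R]_(1 + m) -> R) t x :
  partial o H (pt t x) = (fun s => H (pt s x))^`()%classic t.
Proof.
rewrite /partial /derive /derive1; set d := (fun _ : R => _); set d' := (fun _ : R => _).
suff -> : d = d' by [].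
apply: funext => s; rewrite /d /d' /=.
congr (_ *: (H _ - _)).
rewrite /basis_vec delta_mx_lshift /warped_point scale_row_mx scaler0 add_row_mx add0r.
congr row_mx; apply/matrixP => i j; rewrite !ord1 !mxE !eqxx /=.
by rewrite mulr1 !mulr1n.
Qed.

Lemma sum_warped (E : 'I_(1 + m) -> R) : \sum_i E i = E o + \sum_a E (r a).
Proof. by rewrite big_split_ord big_ord1. Qed.

Lemma warped_metric00 y : g y o o = 1.
Proof. by rewrite block_mxEul mxE eqxx. Qed.
Lemma warped_metric0r y a : g y o (r a) = 0.
Proof. by rewrite block_mxEur mxE. Qed.
Lemma warped_metricr0 y a : g y (r a) o = 0.
Proof. by rewrite block_mxEdl mxE. Qed.
Lemma warped_metricrr t x a b : g (pt t x) (r a) (r b) = f t ^+ 2 * h x a b.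
Proof. by rewrite block_mxEdr mxE warped_point_base warped_point_fiber. Qed.

Lemma invmx_warped t x : J t -> U x ->
  invmx (g (pt t x)) = block_mx 1%:M 0 0 ((f t ^+ 2)^-1 *: invmx (h x)).
Proof.
move=> Jt Ux.
have f0 : f t ^+ 2 != 0 by rewrite expf_neq0 // gt_eqF ?fpos.
have hu : f t ^+ 2 *: h x \in unitmx by rewrite unitmxZ ?unitfE // hunit.
rewrite /warped_metric warped_point_base warped_point_fiber invmx_block_diag.
  by rewrite invmx1 invmxZ // hunit.
by rewrite unitmxE det_ublock det1 mul1r -unitmxE.
Qed.

Lemma warping_derivable t : J t -> derivable f t 1.
Proof. exact: (fsmooth 0). Qed.

Lemma warping_derivable2 t : J t -> derivable f^`()%classic t 1.
Proof. exact: (fsmooth 1). Qed.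

Lemma derive1_warping_sqr t : J t ->
  (fun s => f s ^+ 2)^`()%classic t = f t * f^`()%classic t *+ 2.
Proof.
move=> Jt; rewrite derive1E [LHS](@deriveX _ _ f 2 t 1 (warping_derivable _ Jt)) -derive1E.
by rewrite /GRing.scale /= expr1 -mulrnAl mulr_natl.
Qed.

Lemma partial_warped_metricrr_base t x a b : J t ->
  partial o (fun y => g y (r a) (r b)) (pt t x) =
  f t * f^`()%classic t *+ 2 * h x a b.
Proof.
move=> Jt; rewrite partial_base.
under [X in derive1 X]eq_fun do rewrite warped_metricrr.
rewrite derive1Mr ?derive1_warping_sqr //.
exact: (@derivableX _ _ f 2 t 1 (warping_derivable _ Jt)).
Qed.

Lemma partial_warped_metricrr_fiber t x a b c : U x ->
  partial (r c) (fun y => g y (r a) (r b)) (pt t x) =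
  f t ^+ 2 * partial c (fun y => h y a b) x.
Proof.
move=> Ux; rewrite partial_fiber.
under [X in partial _ X]eq_fun do rewrite warped_metricrr.
by rewrite /partial deriveMl //; exact: hder.
Qed.

Lemma partial_warped_metric0 i j y : partial i (fun y => g y o j) y = 0.
Proof.
case: (split_ordP j) => k ->; last first.
  by under [X in partial _ X]eq_fun do rewrite warped_metric0r; rewrite partial_cst.
by rewrite ord1; under [X in partial _ X]eq_fun do rewrite warped_metric00; rewrite partial_cst.
Qed.

Lemma partial_warped_metricr0 i a y : partial i (fun y => g y (r a) o) y = 0.
Proof. by under [X in partial _ X]eq_fun do rewrite warped_metricr0; rewrite partial_cst. Qed.

(** * Christoffel symbols of the warped metric *)

Section Christoffel.
Variables (t : R) (x : 'rV[R]_m).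
Hypotheses (Jt : J t) (Ux : U x).

Lemma christoffel_base i j : christoffel g o i j (pt t x) =
  2^-1 * (partial i (fun y => g y j o) (pt t x) + partial j (fun y => g y i o) (pt t x)
     - partial o (fun y => g y i j) (pt t x)).
Proof.
rewrite /christoffel sum_warped invmx_warped // block_mxEul mxE eqxx mul1r.
rewrite big1 ?addr0 // => a _.
by rewrite block_mxEur mxE mul0r.
Qed.

Lemma christoffel_fiber a i j : christoffel g (r a) i j (pt t x) =
  2^-1 * \sum_s (f t ^+ 2)^-1 * invmx (h x) a s *
   (partial i (fun y => g y j (r s)) (pt t x) + partial j (fun y => g y i (r s)) (pt t x)
     - partial (r s) (fun y => g y i j) (pt t x)).
Proof.
rewrite /christoffel sum_warped invmx_warped // block_mxEdl mxE mul0r add0r.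
by under eq_bigr do rewrite block_mxEdr mxE.
Qed.

Lemma christoffel00 i : christoffel g o i o (pt t x) = 0.
Proof.
rewrite christoffel_base; case: (split_ordP i) => k ->;
  by rewrite ?ord1 ?partial_warped_metric0 ?partial_warped_metricr0; ring.
Qed.

Lemma christoffel0_0 i : christoffel g o o i (pt t x) = 0.
Proof.
rewrite christoffel_base; case: (split_ordP i) => k ->;
  by rewrite ?ord1 ?partial_warped_metric0 ?partial_warped_metricr0; ring.
Qed.

Lemma christoffel0rr a b : christoffel g o (r a) (r b) (pt t x) =
  - (f t * f^`()%classic t) * h x a b.
Proof.
rewrite christoffel_base !partial_warped_metricr0 partial_warped_metricrr_base //.
by field.
Qed.

Lemma christoffelr00 a : christoffel g (r a) o o (pt t x) = 0.
Proof.
by rewrite christoffel_fiber big1 ?mulr0 // => s _; rewrite !partial_warped_metric0; ring.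
Qed.

(** This contraction of [h] with its inverse uses the symmetry of [h], since the summed index is the
    second one in both factors. It collapses the sums in the mixed Christoffel symbols. *)
Lemma sum_invmx_fiber a b : \sum_s invmx (h x) a s * h x b s = (a == b)%:R.
Proof.
have -> : (a == b)%:R = (invmx (h x) *m h x) a b by rewrite mulVmx ?hunit // mxE.
by rewrite mxE; apply: eq_bigr => s _; congr (_ * _); rewrite -[in LHS](hsym _ Ux) mxE.
Qed.

Lemma f_neq0 : f t != 0. Proof. by rewrite gt_eqF ?fpos. Qed.

Lemma christoffelrr0 a b : christoffel g (r a) (r b) o (pt t x) =
  f^`()%classic t / f t * (a == b)%:R.
Proof.
(* The Kronecker delta is expanded back into the contraction, so that the two sums over [s] can be
   compared term by term. *)
rewrite christoffel_fiber -sum_invmx_fiber !mulr_sumr; apply: eq_bigr => s _.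
rewrite partial_warped_metric0 partial_warped_metricrr_base // partial_warped_metricr0.
field; exact: f_neq0.
Qed.

Lemma christoffelr0r a b : christoffel g (r a) o (r b) (pt t x) =
  f^`()%classic t / f t * (a == b)%:R.
Proof.
rewrite christoffel_fiber -sum_invmx_fiber !mulr_sumr; apply: eq_bigr => s _.
rewrite !partial_warped_metric0 partial_warped_metricrr_base //.
field; exact: f_neq0.
Qed.

Lemma christoffelrrr a b c :
  christoffel g (r a) (r b) (r c) (pt t x) = christoffel h a b c x.
Proof.
rewrite christoffel_fiber /christoffel; congr (_ * _); apply: eq_bigr => s _.
rewrite !partial_warped_metricrr_fiber //.
field; exact: f_neq0.
Qed.
End Christoffel.

(** The closed forms of the Christoffel symbols hold only over [J] and [U]. These sets are open and
    a partial derivative depends only on the germ, so the closed forms may be differentiated. *)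
Lemma near_partial_fiber (H : 'rV[R]_(1 + m) -> R) (K : 'rV[R]_m -> R) t x a : U x ->
  (forall y, U y -> H (pt t y) = K y) -> partial (r a) H (pt t x) = partial a K x.
Proof.
move=> Ux HK; rewrite partial_fiber; apply: near_eq_derive.
have : nbhs x U by exact: open_nbhs_nbhs.
by apply: filterS => y Uy; rewrite HK.
Qed.

Lemma near_partial_base (H : 'rV[R]_(1 + m) -> R) (K : R -> R) t x : J t ->
  (forall s, J s -> H (pt s x) = K s) -> partial o H (pt t x) = K^`()%classic t.
Proof.
move=> Jt HK; rewrite partial_base !derive1E; apply: near_eq_derive.
have : nbhs t J by exact: open_nbhs_nbhs.
by apply: filterS => s Js; rewrite HK.
Qed.

(** * Ricci components of the warped metric *)

Section Ricci.
Variables (t : R) (x : 'rV[R]_m).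
Hypotheses (Jt : J t) (Ux : U x).

Local Notation d1 := (f^`()%classic t).
Local Notation d2 := (f^`()^`()%classic t).

Lemma derive1_log_warping : (fun s => f^`()%classic s / f s)^`()%classic t =
  d2 / f t - (d1 / f t) ^+ 2.
Proof.
have f0 := f_neq0 _ Jt; have df := warping_derivable _ Jt.
rewrite derive1E [LHS](deriveM (warping_derivable2 _ Jt) (derivableV f0 df)) deriveV //.
rewrite -!derive1E /GRing.scale /=.
by move: (f t) d1 d2 f0 => y y1 y2 y0; field.
Qed.

Lemma derive1_warping_prod : (fun s => - (f s * f^`()%classic s))^`()%classic t =
  - (d1 ^+ 2 + f t * d2).
Proof.
rewrite derive1E [LHS](deriveN (derivableM (warping_derivable _ Jt) (warping_derivable2 _ Jt))).
rewrite (deriveM (warping_derivable _ Jt) (warping_derivable2 _ Jt)) -!derive1E /GRing.scale /=.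
by move: (f t) d1 d2 => y y1 y2; ring.
Qed.

Lemma derivable_warping_prod : derivable (fun s => - (f s * f^`()%classic s)) t 1.
Proof. exact: (derivableN (derivableM (warping_derivable _ Jt) (warping_derivable2 _ Jt))). Qed.

Lemma riemann_diag (k : 'I_(1 + m)) i j : riemann g k i i j (pt t x) = 0.
Proof. by rewrite /riemann subrr add0r big1 // => s _; rewrite subrr. Qed.

Lemma sum_delta (a : 'I_m) (E : 'I_m -> R) : \sum_b E b * (b == a)%:R = E a.
Proof.
rewrite (bigD1 a) //= eqxx mulr1 big1 ?addr0 // => b ba.
by rewrite (negbTE ba) mulr0.
Qed.

Lemma sum_delta_sym (a : 'I_m) (E : 'I_m -> R) : \sum_b E b * (a == b)%:R = E a.
Proof. by under eq_bigr do rewrite eq_sym; rewrite sum_delta. Qed.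

Lemma ricci_warped00 : ricci g (pt t x) o o = - m%:R * d2 / f t.
Proof.
rewrite mxE sum_warped riemann_diag add0r.
(* Each fiber direction contributes -f''/f: the quadratic Christoffel terms cancel the (f'/f)^2
   produced by differentiating f'/f. *)
rewrite (eq_bigr (fun=> - (d2 / f t))).
  by rewrite sumr_const card_ord -mulr_natl; ring.
move=> a _; rewrite /riemann sum_warped.
rewrite (@near_partial_fiber _ (fun=> 0)) //; last by move=> y Uy; rewrite christoffelr00.
rewrite (@near_partial_base _ (fun s => f^`()%classic s / f s)) //; last first.
  by move=> s Js; rewrite christoffelrr0 // eqxx mulr1.
rewrite partial_cst derive1_log_warping.
rewrite !christoffelr00 // !christoffel00 //.
under eq_bigr => s _ do
  rewrite christoffelr00 // christoffelrr0 // christoffelr0r // mulr0 sub0r -mulNr mulrA.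
by rewrite sum_delta eqxx mulr1; field; exact: f_neq0.
Qed.

(** The symbols being differentiated are constant in the direction of differentiation, and the two
    quadratic sums are the same multiple f'/f of a Christoffel symbol of [h]. *)
Lemma ricci_warped0r b : ricci g (pt t x) o (r b) = 0.
Proof.
rewrite mxE sum_warped riemann_diag add0r.
apply: big1 => a _; rewrite /riemann sum_warped.
rewrite (@near_partial_fiber _ (fun=> f^`()%classic t / f t * (a == b)%:R)) //; last first.
  by move=> y Uy; rewrite christoffelr0r.
rewrite (@near_partial_base _ (fun=> christoffel h a a b x)) //; last first.
  by move=> s Js; rewrite christoffelrrr.
rewrite partial_cst derive1_cst christoffel0_0 // christoffelr00 //.
under eq_bigr => s _ do rewrite !christoffelr0r // !christoffelrrr // mulrA.
rewrite sumrB sum_delta.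
under eq_bigr do rewrite mulrAC.
by rewrite sum_delta_sym; ring.
Qed.

Lemma ricci_warpedrr b c : ricci g (pt t x) (r b) (r c) =
  ricci h x b c - (f t * d2 + (m%:R - 1) * d1 ^+ 2) * h x b c.
Proof.
rewrite mxE sum_warped.
(* Contribution of the base direction to the trace. *)
have -> : riemann g o o (r b) (r c) (pt t x) = - (f t * d2) * h x b c.
  rewrite /riemann sum_warped.
  rewrite (@near_partial_base _ (fun s => - (f s * f^`()%classic s) * h x b c)) //; last first.
    by move=> s Js; rewrite christoffel0rr.
  rewrite (@near_partial_fiber _ (fun=> 0)) //; last first.
    by move=> y Uy; rewrite christoffel0_0.
  rewrite partial_cst derive1Mr; last exact: derivable_warping_prod.
  rewrite derive1_warping_prod !christoffel0_0 // christoffel00 //.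
  under eq_bigr => s _ do
    rewrite christoffel0_0 // christoffelr0r // christoffel0rr // mul0r sub0r mulrA -mulNr.
  by rewrite sum_delta; field; exact: f_neq0.
(* Each fiber direction contributes the intrinsic curvature of [h] with the Gauss equation
   correction. Summed over [a], the corrections give -(m - 1) f'^2 times [h]. *)
rewrite (eq_bigr (fun a => riemann h a a b c x - d1 ^+ 2 * h x b c
   + d1 ^+ 2 * h x a c * (a == b)%:R)); last first.
  move=> a _; rewrite /riemann sum_warped.
  rewrite (@near_partial_fiber _ (christoffel h a b c)) //; last first.
    by move=> y Uy; rewrite christoffelrrr.
  rewrite (@near_partial_fiber _ (christoffel h a a c)) //; last first.
    by move=> y Uy; rewrite christoffelrrr.
  rewrite !christoffelrr0 // !christoffel0rr //.
  under eq_bigr => s _ do rewrite !christoffelrrr //.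
  rewrite eqxx mulr1.
  move: (partial a _ x) (partial b _ x) (\sum_s _) ((a == b)%:R : R) => A B S e.
  by move: (f t) d1 (h x b c) (h x a c) (f_neq0 _ Jt) => y y1 k1 k2 y0; field.
rewrite big_split /= sum_delta sumrB sumr_const card_ord -mulr_natl mxE.
by ring.
Qed.
End Ricci.
End WarpedCurvature.

(** * Ricci tensor of a metric of constant curvature *)

Lemma posdef_unitmx {R : realType} {n : nat} (M : 'M[R]_n) : posdef M -> M \in unitmx.
Proof.
move=> Mpos; rewrite -row_free_unit; apply: inj_row_free => v vM.
apply: contrapT => /eqP/Mpos.
by rewrite vM mul0mx mxE ltxx.
Qed.

(** * Bilinear forms given by matrices *)

Section QuadraticForms.
Context {R : realType} {n : nat}.
Implicit Types (D S : 'M[R]_n) (u v w : 'rV[R]_n).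

Definition bil D u v : R := (u *m D *m v^T) 0 0.

Lemma bilDl D u v w : bil D (u + v) w = bil D u w + bil D v w.
Proof. by rewrite /bil !mulmxDl mxE. Qed.

Lemma bilZl D a u v : bil D (a *: u) v = a * bil D u v.
Proof. by rewrite /bil -!scalemxAl mxE. Qed.

Lemma bilDr D u v w : bil D u (v + w) = bil D u v + bil D u w.
Proof. by rewrite /bil linearD mulmxDr mxE. Qed.

Lemma bilZr D a u v : bil D u (a *: v) = a * bil D u v.
Proof. by rewrite /bil linearZ -scalemxAr mxE. Qed.

Lemma bil_trmx D u v : bil D^T u v = bil D v u.
Proof. by rewrite /bil -[in RHS](trmxK (v *m D *m u^T)) [RHS]mxE !trmx_mul trmxK mulmxA. Qed.

Lemma bil_delta D i j : bil D (delta_mx 0 i) (delta_mx 0 j) = D i j.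
Proof. by rewrite /bil -rowE trmx_delta -colE !mxE. Qed.

Lemma bilE D u v : bil D u v = \sum_i \sum_j u 0 i * v 0 j * D i j.
Proof.
rewrite /bil mxE exchange_big /=; apply: eq_bigr => j _.
by rewrite !mxE mulr_suml; apply: eq_bigr => i _; rewrite mulrAC.
Qed.

(** Polarization at sums of two basis vectors. *)
Lemma alternating_trmx D : (forall u, bil D u u = 0) -> D^T = - D.
Proof.
move=> D0; apply/matrixP => i j; rewrite !mxE -!bil_delta; apply/eqP.
have := D0 (delta_mx 0 i + delta_mx 0 j).
by rewrite bilDl !bilDr !D0 add0r addr0 addrC => /eqP; rewrite addr_eq0.
Qed.

(** Transposition and cyclicity show that the trace is its own opposite. *)
Lemma trace_antisym_sym D S : D^T = - D -> S^T = S -> \tr (D *m S) = 0.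
Proof.
move=> DT ST; have : \tr (D *m S) = - \tr (D *m S).
  by rewrite -[LHS]mxtrace_tr trmx_mul DT ST mulmxN raddfN /= mxtrace_mulC.
by move=> /eqP; rewrite -addr_eq0 -mulr2n mulrn_eq0 /= => /eqP.
Qed.
End QuadraticForms.

(** * The Jacobi operator and its trace *)

Section ConstantCurvature.
Context {R : realType} {n : nat}.
Variables (g : 'rV[R]_n -> 'M[R]_n) (x : 'rV[R]_n) (kappa : R).
Hypothesis gsym : (g x)^T = g x.
Hypothesis gpos : posdef (g x).
Hypothesis sec : forall u v, row_free (col_mx u v) -> sectional g x u v = kappa.

(* Jacobi operator X |-> R(X, u) u, whose trace is Ric(u, u). *)
Definition jacobi (u : 'rV[R]_n) : 'M[R]_n :=
  \matrix_(i, l) \sum_j \sum_k u 0 j * u 0 k * riemann g l i j k x.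

Lemma jacobiE u v : curvature g x v u u = v *m jacobi u.
Proof.
apply/rowP => l; rewrite !mxE; apply: eq_bigr => i _.
rewrite mxE mulr_sumr; apply: eq_bigr => j _.
by rewrite mulr_sumr; apply: eq_bigr => k _; rewrite !mulrA.
Qed.

Lemma jacobi_trace u : \tr (jacobi u) = bil (ricci g x) u u.
Proof.
rewrite bilE /mxtrace; under eq_bigr do rewrite mxE.
rewrite exchange_big /=; apply: eq_bigr => j _.
rewrite exchange_big /=; apply: eq_bigr => k _.
by rewrite mxE mulr_sumr.
Qed.

Lemma riemann_antisym l i j k : riemann g l i j k x = - riemann g l j i k x.
Proof.
rewrite /riemann opprD opprB -sumrN; congr (_ + _).
by apply: eq_bigr => s _; rewrite opprB.
Qed.

(** This is R(u, u)u = 0: exchanging the two antisymmetric slots negates the double sum. *)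
Lemma jacobi_self u : u *m jacobi u = 0.
Proof.
apply/rowP => l; rewrite !mxE.
pose T i j := \sum_k u 0 i * u 0 j * u 0 k * riemann g l i j k x.
have -> : \sum_i u 0 i * jacobi u i l = \sum_i \sum_j T i j.
  apply: eq_bigr => i _; rewrite mxE mulr_sumr; apply: eq_bigr => j _.
  by rewrite mulr_sumr; apply: eq_bigr => k _; rewrite !mulrA.
have TN i j : T i j = - T j i.
  rewrite /T -sumrN; apply: eq_bigr => k _.
  by rewrite riemann_antisym mulrN [u 0 i * _]mulrC.
have : \sum_i \sum_j T i j = - \sum_i \sum_j T i j.
  rewrite [in LHS]exchange_big -sumrN /=; apply: eq_bigr => i _.
  by rewrite -sumrN; apply: eq_bigr => j _; rewrite -TN.
by move=> /eqP; rewrite -addr_eq0 -mulr2n mulrn_eq0 /= => /eqP.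
Qed.

Lemma bil_sym u v : bil (g x) u v = bil (g x) v u.
Proof. by rewrite -bil_trmx gsym. Qed.

(** For independent vectors this is the definition of sectional curvature with its denominator
    cleared. The hypothesis [sec] says nothing about dependent pairs; there both sides vanish. *)
Lemma jacobi_constant u v : bil (jacobi u *m g x) v v =
  kappa * (bil (g x) v v * bil (g x) u u - bil (g x) v u ^+ 2).
Proof.
(* For nonzero [u], [p w] is |u|^2 times the component of [w] orthogonal to [u]. It detects whether
   [v] is a multiple of [u], and its squared length is |u|^2 times the Gram determinant. *)
pose p w := bil (g x) u u *: w - bil (g x) w u *: u.
have pu : p u = 0 by rewrite /p subrr.
have pD a b w z : p (a *: w + b *: z) = a *: p w + b *: p z.
  rewrite /p bilDl !bilZl; apply/rowP => i; rewrite !mxE; ring.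
have [u0|u0] := eqVneq u 0.
  have u00 : u = 0 *: u by rewrite u0 scaler0.
  rewrite {2 3 4}u00 !bilZr bilZl.
  have -> : jacobi u = 0.
    apply/matrixP => i l; rewrite !mxE big1 // => j _.
    by rewrite big1 // => k _; rewrite u0 !mxE !mul0r.
  by rewrite mul0mx /bil mulmx0 mul0mx mxE; ring.
have uu : 0 < bil (g x) u u by exact: gpos.
have [pv|pv] := eqVneq (p v) 0.
  have -> : v = (bil (g x) v u / bil (g x) u u) *: u.
    move/eqP: pv; rewrite subr_eq0 => /eqP pv.
    by rewrite mulrC -scalerA -pv scalerA mulVf ?scale1r // gt_eqF.
  rewrite {1}/bil !mulmxA -scalemxAl jacobi_self scaler0 !mul0mx mxE.
  by rewrite !bilZl !bilZr; ring.
(* Applying [p] to a relation a v + b u = 0 leaves a [p v] = 0, hence a = 0 and then b = 0. *)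
have fr : row_free (col_mx v u).
  apply: inj_row_free => w; rewrite -[w]hsubmxK mul_row_col => vu.
  have [a la] : exists a, lsubmx w = a%:M by exists (lsubmx w 0 0); rewrite -mx11_scalar.
  have [b rb] : exists b, rsubmx w = b%:M by exists (rsubmx w 0 0); rewrite -mx11_scalar.
  move: vu; rewrite la rb !mul_scalar_mx => vu.
  have := pD a b v u; rewrite vu pu scaler0 addr0 => /esym/eqP.
  have -> : p 0 = 0.
    by have := pD 0 0 u u; rewrite !scale0r !addr0.
  rewrite scaler_eq0 (negbTE pv) orbF => /eqP a0.
  move: vu; rewrite a0 scale0r add0r => /eqP; rewrite scaler_eq0 (negbTE u0) orbF => /eqP ->.
  by rewrite !raddf0 row_mx0.
have d0 : bil (g x) v v * bil (g x) u u - bil (g x) v u ^+ 2 != 0.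
  have H : 0 < bil (g x) (p v) (p v) by exact: gpos.
  rewrite /p -!scaleNr bilDl !bilDr !bilZl !bilZr (bil_sym u v) in H.
  apply/negP => /eqP d0; move: H.
  have -> : forall a b c : R, a * (a * b) + a * (- c * c) + (- c * (a * c) + - c * (- c * a))
     = a * (b * a - c ^+ 2) by move=> *; ring.
  by rewrite d0 mulr0 ltxx.
have := sec _ _ fr; rewrite /sectional /inner jacobiE.
rewrite -!/(bil _ _ _) => <-.
by rewrite divfK // /bil mulmxA.
Qed.

(** The Jacobi form is known only on the diagonal. Its difference [D] from the constant curvature
    model is therefore alternating, hence antisymmetric, and has zero trace against the symmetric
    inverse metric. That trace compares Ric(u, u) with the trace of the model. *)
Lemma ricci_constant u :
  bil (ricci g x) u u = kappa * (n%:R - 1) * bil (g x) u u.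
Proof.
have gu := posdef_unitmx _ gpos.
pose D := jacobi u *m g x
  - kappa *: (bil (g x) u u *: g x - g x *m u^T *m u *m g x).
have DT : D^T = - D.
  apply: alternating_trmx => v.
  have -> : bil D v v = bil (jacobi u *m g x) v v -
      kappa * (bil (g x) u u * bil (g x) v v - bil (g x) v u ^+ 2).
    rewrite /bil /D mulmxBr mulmxBl mxE [in X in _ + X]mxE; congr (_ - _).
    rewrite -scalemxAr -scalemxAl mxE mulmxBr mulmxBl mxE [in X in _ + X]mxE.
    rewrite -scalemxAr -scalemxAl mxE; congr (_ * (_ - _)).
    have -> : v *m (g x *m u^T *m u *m g x) *m v^T
      = (v *m g x *m u^T) *m (u *m g x *m v^T) by rewrite !mulmxA.
    rewrite mxE big_ord1 expr2; congr (_ * _).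
    exact: bil_sym.
  by rewrite jacobi_constant; ring.
have ST : (invmx (g x))^T = invmx (g x) by rewrite trmx_inv gsym.
have := trace_antisym_sym _ _ DT ST.
rewrite /D mulmxBl mulmxK // raddfB /= jacobi_trace => /eqP; rewrite subr_eq0 => /eqP ->.
rewrite -scalemxAl mulmxBl -scalemxAl mulmxK // mulmxV //.
rewrite linearZ /= raddfB /= linearZ /= mxtrace1.
have -> : \tr (g x *m u^T *m u) = bil (g x) u u.
  by rewrite -mulmxA mxtrace_mulC -mulmxA mxtrace_mulC /mxtrace big_ord1.
by rewrite /GRing.scale /=; ring.
Qed.
End ConstantCurvature.

(** * The differential equation of the warping function *)

Section Interval.
Context {R : realType}.
Implicit Types (I J : set R) (G : R -> R).

Lemma derivable_interval_continuous I G (s t : R) : is_interval I -> I s -> I t ->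
  (forall z, I z -> derivable G z 1) -> {within `[s, t], continuous G}.
Proof.
move=> iI Is It dG; apply: derivable_within_continuous => z.
by rewrite in_itv /= => /(iI _ _ Is It) /dG.
Qed.

Lemma nonvanishing_sign I G : is_interval I ->
  (forall t, I t -> derivable G t 1) -> (forall t, I t -> G t != 0) ->
  (forall t, I t -> 0 < G t) \/ (forall t, I t -> G t < 0).
Proof.
move=> iI dG G0; apply: contrapT => /not_orP[/existsNP[s /not_implyP[Is /negP]]].
rewrite -leNgt => Gs /existsNP[t /not_implyP[It /negP]].
rewrite -leNgt => Gt.
have absurd a b : a <= b -> I a -> I b ->
    Num.min (G a) (G b) <= 0 <= Num.max (G a) (G b) -> False.
  move=> ab Ia Ib; have cG := derivable_interval_continuous _ _ _ _ iI Ia Ib dG.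
  move=> /(IVT ab cG)[c]; rewrite in_itv /= => /(iI _ _ Ia Ib) /G0 /eqP.
  by [].
case: (leP s t) => [st|/ltW ts]; [apply: (absurd _ _ st)|apply: (absurd _ _ ts)] => //;
  by rewrite ge_min le_max Gs Gt ?orbT.
Qed.

Lemma derive0_interval_eq I G (s t : R) : is_interval I -> I s -> I t ->
  (forall z, I z -> is_derive z 1 G 0) -> G s = G t.
Proof.
move=> iI; wlog st : s t / s <= t.
  by move=> H Is It G0; case: (leP s t) => [st|/ltW ts]; [|symmetry]; exact: H.
move=> Is It G0; have dG z : I z -> derivable G z 1 by move=> /G0[].
have cG := derivable_interval_continuous _ _ _ _ iI Is It dG.
have [|c _] := @MVT_segment _ G (fun=> 0) _ _ st _ cG.
  by move=> z; rewrite in_itv /= => /andP[/ltW sz /ltW zt]; apply/G0/(iI s t); rewrite ?sz.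
by rewrite mul0r => /eqP; rewrite subr_eq0 => /eqP.
Qed.

(** Carries a conserved quantity from the phase to the flat point, which may be an endpoint outside
    [I]. If the values differed, continuity at [t0] would give points of [I] where [G] differs from
    [G t]. *)
Lemma derive0_closure_eq I G (t0 t : R) : is_interval I -> I t ->
  closure I t0 -> derivable G t0 1 ->
  (forall z, I z -> is_derive z 1 G 0) -> G t = G t0.
Proof.
move=> iI It clI /derivable1_diffP/differentiable_continuous cG G0.
apply/eqP/negPn/negP => Gtt0.
have nb : nbhs (G t0) [set y | y != G t].
  by apply: open_nbhs_nbhs; split; [exact: open_neq | rewrite /= eq_sym].
have [s [Is /eqP]] := clI _ (cG _ nb).
by apply; exact: derive0_interval_eq G0.
Qed.

(** Membership of [b] in [N] is left open. If [b] is missing then [N] is the singleton of [a], the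
    quotient is 1, and this contradicts 1 < [C]. *)
Lemma inf_sup_pinching (N : set R) (a b C : R) :
  N a -> N `<=` [set a; b] -> 0 < a -> 0 < b -> 1 < C ->
  inf N / sup N = C^-1 -> b = C * a \/ a = C * b.
Proof.
move=> Na sN a0 b0 C1.
have C0 : C != 0 by rewrite gt_eqF // (lt_trans ltr01).
have extremal (x y : R) : N x -> N y -> lbound N x -> ubound N y -> 0 < y ->
    inf N / sup N = C^-1 -> y = C * x.
  move=> Nx Ny lx uy y0.
  have -> : inf N = x.
    apply/eqP; rewrite eq_le lb_le_inf // ?andbT; last by exists x.
    by apply: ge_inf => //; exists x.
  have -> : sup N = y.
    apply/eqP; rewrite eq_le ge_sup //=; last by exists x.
    by apply: ub_le_sup => //; exists y.
  move=> /(congr1 ( *%R^~ (C * y))); rewrite mulrCA mulfVK ?gt_eqF // => ->.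
  by rewrite mulKf.
have [Nb|Nb] := pselect (N b).
  have [ab|/ltW ba] := leP a b.
    by move=> e; left; apply: extremal => // y /sN[]->.
  by move=> e; right; apply: extremal => // y /sN[]->.
have Na1 y : N y -> y = a by move=> Ny; case: (sN y Ny) => // yb; rewrite yb in Ny.
move/(extremal a a) => H; exfalso.
have : a = C * a by apply: H => // y /Na1 ->.
by move=> /eqP; rewrite -subr_eq0 -{1}[a]mul1r -mulrBl mulf_eq0 (gt_eqF a0) orbF subr_eq0 lt_eqF.
Qed.

Lemma is_derive_lim (f : R -> R) t : derivable f t 1 -> is_derive t 1 f (f^`()%classic t).
Proof. by move=> df; rewrite derive1E; exact: derivableP. Qed.

(** * A conservation law for the warping function *)

Variables (I J : set R) (f : R -> R) (kappa : R).
Hypotheses (Iint : is_interval I) (Iopen : open I) (IJ : I `<=` J).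
Hypothesis fsmooth : smooth_fun_on J f.
Hypothesis fpos : forall t, J t -> 0 < f t.

Local Notation f1 := (f^`()%classic).
Local Notation f2 := (f^`()^`()%classic).

Lemma is_derive_f t : J t -> is_derive t 1 f (f1 t).
Proof. by move=> Jt; apply: is_derive_lim; exact: (fsmooth 0). Qed.

Lemma is_derive_f1 t : J t -> is_derive t 1 f1 (f2 t).
Proof. by move=> Jt; apply: is_derive_lim; exact: (fsmooth 1). Qed.

(** Divided by f^2, this is the sectional curvature of the planes tangent to the fibers. *)
Definition defect t : R := kappa - f1 t ^+ 2.

Lemma is_derive_defect t : J t -> is_derive t 1 defect (- (f1 t * f2 t *+ 2)).
Proof.
move=> Jt; have H := is_deriveB (is_derive_cst kappa t 1) (is_deriveX 2 (is_derive_f1 _ Jt)).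
apply: (is_derive_eq H).
by rewrite sub0r /GRing.scale /= expr1 mulr2n; ring.
Qed.

(* f^(2c) (kappa - f'^2), constant along solutions of f f'' = c (kappa - f'^2). *)
Definition first_integral c t : R := expR (c *+ 2 * ln (f t)) * defect t.

(** The last factor is the residual of the equation f f'' = c w, with w the defect. The power of f
    goes through [expR] and [ln] because the exponent 2c is an arbitrary real number. *)
Lemma is_derive_first_integral c t : J t -> is_derive t 1 (first_integral c)
  (expR (c *+ 2 * ln (f t)) * (f1 t / f t *+ 2) * (c * defect t - f t * f2 t)).
Proof.
move=> Jt; have ft := fpos _ Jt.
have Hln := is_derive1_comp (is_derive1_ln ft) (is_derive_f _ Jt).
have Hc := is_deriveM (is_derive_cst (c *+ 2) t 1) Hln.
have H := is_deriveM (is_derive1_comp (is_derive_expR _) Hc) (is_derive_defect _ Jt).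
apply: (is_derive_eq H).
rewrite /GRing.scale /= /GRing.mul_fun /=.
by field; rewrite gt_eqF.
Qed.

(** Since [t0] lies in [J], f is positive there, so the first integral is differentiable at [t0]
    whatever the sign of [c]. *)
Lemma defect_rigidity c t0 : closure I t0 -> J t0 -> defect t0 = 0 ->
  (forall t, I t -> f t * f2 t = c * defect t) ->
  forall t, I t -> f2 t = 0.
Proof.
move=> clI Jt0 w0 ode t It.
have : first_integral c t = first_integral c t0.
  apply: (derive0_closure_eq _ _ _ _ Iint It clI).
    by case: (is_derive_first_integral c _ Jt0).
  move=> z Iz; apply: (is_derive_eq (is_derive_first_integral c _ (IJ _ Iz))).
  by rewrite ode // subrr mulr0.
rewrite /first_integral w0 mulr0 => /eqP.
rewrite mulf_eq0 gt_eqF ?expR_gt0 //= => /eqP wt.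
have := ode _ It; rewrite wt mulr0 => /eqP.
by rewrite mulf_eq0 gt_eqF ?fpos //=; [move/eqP|exact: IJ].
Qed.

(** Serves the case in which f f'' drops out of the pinching relation. Differentiating a vanishing
    defect gives f' f'' = 0, so f' = 0 on the open set [I], and then f'' = 0 there. *)
Lemma defect0_empty : (forall t, I t -> defect t = 0) ->
  (forall t, I t -> f2 t != 0) -> ~ (I !=set0).
Proof.
move=> w0 f20 [t It].
have f10 s : I s -> f1 s = 0.
  move=> Is; have nI : nbhs s I by exact: open_nbhs_nbhs.
  have [_ dw] := is_derive_defect _ (IJ _ Is).
  have : 'D_1 defect s = 'D_1 (fun=> 0) s.
    by apply: near_eq_derive; apply: filterS nI => z; exact: w0.
  rewrite dw derive_cst => /eqP; rewrite oppr_eq0 mulrn_eq0 /= mulf_eq0.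
  by rewrite (negbTE (f20 _ Is)) orbF => /eqP.
have nI : nbhs t I by exact: open_nbhs_nbhs.
have /eqP := f20 _ It; apply.
rewrite derive1E (@near_eq_derive _ _ _ _ (fun=> 0)) ?derive_cst //.
by apply: filterS nI => z; exact: f10.
Qed.
End Interval.

(** * Ricci phases of warped products *)

Section WarpedPhase.
Context {R : realType} {m : nat} {F : topologicalType}.
Variables (gF : atlas R F m) (kappa : R) (J : set R) (f : R -> R).
Hypothesis m2 : (2 <= m)%N.
Hypothesis gF_riem : riemannian_manifold gF.
Hypothesis gF_sec : constant_sectional_curvature gF kappa.
Hypothesis Jopen : open J.
Hypothesis fsmooth : smooth_fun_on J f.
Hypothesis fpos : forall t, J t -> 0 < f t.

Local Notation f1 := (f^`()%classic).
Local Notation f2 := (f^`()^`()%classic).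
Local Notation W := (warped_product J f gF).

Definition lambda_base t : R := - m%:R * f2 t / f t.

Definition lambda_fiber t : R :=
  - f2 t / f t + (m%:R - 1) * defect f kappa t / f t ^+ 2.

(** * Ricci form and eigenvalues at a point *)

Section Point.
Variables (t : R) (p : F) (i : Defs.index gF).
Hypotheses (Jt : J t) (ip : dom i p).

Local Notation x := (Defs.coord i p).
Local Notation h := (Defs.metric i).
Local Notation Ric := (ricci (warped_metric f h) (warped_point t x)).

Lemma image_dom : (Defs.coord i @` dom i) x. Proof. by exists p. Qed.

Lemma warping_neq0 : f t != 0. Proof. by rewrite gt_eqF ?fpos. Qed.

Lemma fiber_metric_pos u : u != 0 -> 0 < bil (h x) u u.
Proof. by apply: (rm_metric_posdef gF_riem); exact: image_dom. Qed.

(** Ric is given as a block triangular matrix with [c] unspecified, and [D] is described by its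
    quadratic form, which is what [ricci_constant] provides. Evaluation on pure base and pure fiber
    vectors reads off both lambdas. *)
Lemma ricci_warped_block : exists c D,
  Ric = block_mx (lambda_base t)%:M 0 c D /\
  forall u, bil D u u = lambda_fiber t * f t ^+ 2 * bil (h x) u u.
Proof.
have Uo := @rm_open_image _ _ _ _ gF_riem i.
have hder a b c y : (Defs.coord i @` dom i) y ->
    derivable (fun y => h y a b) y (basis_vec c : 'rV[R]_m).
  by move=> /(rm_metric_smooth gF_riem a b [::])[_]; exact.
have hsym := @rm_metric_sym _ _ _ _ gF_riem i.
have hunit y : (Defs.coord i @` dom i) y -> h y \in unitmx.
  by move=> /(rm_metric_posdef gF_riem)/posdef_unitmx.
have Ux := image_dom.
exists (dlsubmx Ric), (drsubmx Ric); split.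
  rewrite -[LHS]submxK; congr block_mx; apply/matrixP => j k;
    do 2!rewrite [LHS]mxE; rewrite [RHS]mxE.
    by rewrite !ord1 eqxx mulr1n (ricci_warped00 _ _ _ _ Jopen Uo fsmooth fpos hsym hunit).
  by rewrite ord1 (ricci_warped0r _ _ _ _ Jopen Uo fsmooth fpos hder hsym hunit).
move=> u.
have -> : drsubmx Ric =
    ricci h x - (f t * f2 t + (m%:R - 1) * f1 t ^+ 2) *: h x.
  apply/matrixP => j k; do 2!rewrite [LHS]mxE.
  rewrite (ricci_warpedrr _ _ _ _ Jopen Uo fsmooth fpos hder hsym hunit _ _ Jt Ux).
  by rewrite [RHS]mxE [X in _ = _ + X]mxE [in X in _ = _ + X]mxE.
have -> : bil (ricci h x - (f t * f2 t + (m%:R - 1) * f1 t ^+ 2) *: h x) u u =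
    bil (ricci h x) u u - (f t * f2 t + (m%:R - 1) * f1 t ^+ 2) * bil (h x) u u.
  by rewrite /bil mulmxBr mulmxBl -scalemxAr -scalemxAl !mxE.
have hpos := rm_metric_posdef gF_riem Ux.
rewrite (ricci_constant _ _ kappa (hsym _ Ux) hpos); last first.
  by move=> v w; exact: gF_sec.
by rewrite /lambda_fiber /defect; field; exact: warping_neq0.
Qed.

Lemma bil_block (a : R) c (D : 'M[R]_m) (b : R) u :
  bil (block_mx a%:M 0 c D) (row_mx b%:M 0) (row_mx b%:M 0) = b ^+ 2 * a /\
  bil (block_mx a%:M 0 c D) (row_mx 0 u) (row_mx 0 u) = bil D u u.
Proof.
rewrite /bil !mul_row_block !tr_row_mx !mul_row_col !trmx0.
rewrite !(mul0mx, mulmx0, add0r, addr0) tr_scalar_mx -!scalar_mxM mxE eqxx mulr1n.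
by split; first ring.

Qed.

Lemma row1_neq0 : row_mx 1%:M 0 != 0 :> 'rV[R]_(1 + m).
Proof.
apply/eqP => /(congr1 lsubmx); rewrite row_mxKl => /matrixP /(_ 0 0).
by rewrite !mxE /= => /eqP; rewrite oner_eq0.
Qed.

Lemma fiber_vector : exists2 u : 'rV[R]_m, u != 0 & row_mx 0 u != 0 :> 'rV[R]_(1 + m).
Proof.
have u0 : const_mx 1 != 0 :> 'rV[R]_m.
  apply/eqP => /matrixP /(_ 0 (Ordinal (ltnW m2))).
  by rewrite !mxE => /eqP; rewrite oner_eq0.
exists (const_mx 1) => //; apply/eqP => /(congr1 rsubmx); rewrite row_mxKr => /eqP.
by rewrite raddf0 (negbTE u0).
Qed.

Lemma posdef_lambda : posdef Ric -> 0 < lambda_base t /\ 0 < lambda_fiber t.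
Proof.
have [c [D [-> HD]]] := ricci_warped_block => pos; split.
  have := pos _ row1_neq0; rewrite -/(bil _ _ _) (bil_block _ _ _ _ 0).1.
  by rewrite expr1n mul1r.
have [u u0 u0'] := fiber_vector.
have := pos _ u0'; rewrite -/(bil _ _ _) (bil_block _ _ _ 0 _).2 HD.
by rewrite pmulr_lgt0 ?fiber_metric_pos // pmulr_lgt0 // exprn_gt0 ?fpos.
Qed.

Lemma negdef_lambda : negdef Ric -> lambda_base t < 0 /\ lambda_fiber t < 0.
Proof.
have [c [D [-> HD]]] := ricci_warped_block => pos.
have negbil (M : 'M[R]_(1 + m)) v : bil (- M) v v = - bil M v v.
  by rewrite /bil mulmxN mulNmx mxE.
split.
  have := pos _ row1_neq0; rewrite -/(bil _ _ _) negbil (bil_block _ _ _ _ 0).1.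
  by rewrite expr1n mul1r oppr_gt0.
have [u u0 u0'] := fiber_vector.
have := pos _ u0'; rewrite -/(bil _ _ _) negbil (bil_block _ _ _ 0 _).2 HD oppr_gt0.
by rewrite pmulr_llt0 ?fiber_metric_pos // pmulr_llt0 // exprn_gt0 ?fpos.
Qed.

Lemma flat_lambda : Ric = 0 -> lambda_base t = 0 /\ lambda_fiber t = 0.
Proof.
have [c [D [-> HD]]] := ricci_warped_block => R0; split.
  have := (bil_block (lambda_base t) c D 1 0).1; rewrite R0 expr1n mul1r => <-.
  by rewrite /bil mulmx0 mul0mx mxE.
have [u u0 _] := fiber_vector.
have := (bil_block (lambda_base t) c D 0 u).2; rewrite R0 HD.
rewrite {1}/bil mulmx0 mul0mx mxE => /esym/eqP.
rewrite mulf_eq0 (gt_eqF (fiber_metric_pos _ u0)) orbF mulf_eq0 expf_eq0 /=.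
by rewrite (negbTE warping_neq0) orbF => /eqP.
Qed.

Local Notation endo := (ricci_endo (warped_metric f h) (warped_point t x)).

Lemma warped_unit : warped_metric f h (warped_point t x) \in unitmx.
Proof.
rewrite /warped_metric warped_point_base warped_point_fiber unitmxE det_ublock det1 mul1r.
rewrite -unitmxE unitmxZ ?unitfE ?expf_neq0 ?warping_neq0 //.
exact/posdef_unitmx/(rm_metric_posdef gF_riem)/image_dom.
Qed.

Lemma eigenvector_endo l (v : 'rV[R]_(1 + m)) :
  v *m endo = l *: v <-> v *m Ric = l *: (v *m warped_metric f h (warped_point t x)).
Proof.
rewrite /ricci_endo mulmxA; split => [/(congr1 (mulmx^~ (warped_metric f h (warped_point t x))))|->].
  by rewrite mulmxKV ?warped_unit // -scalemxAl.
by rewrite -scalemxAl mulmxK ?warped_unit.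
Qed.

Lemma eigenvalue_base : eigenvalue endo (lambda_base t).
Proof.
apply/eigenvalueP; exists (row_mx 1%:M 0); last exact: row1_neq0.
apply/eigenvector_endo; have [c [D [-> _]]] := ricci_warped_block.
rewrite /warped_metric !mul_row_block !mulmx0 !mul0mx !addr0 !mul1mx.
by rewrite scale_row_mx scaler0 -mul_scalar_mx mulmx1.
Qed.

(* The fiber block of Ric is known here only as a quadratic form, so lambda_fiber
   need not be an eigenvalue; if it is not, the pinching is 1. *)
Lemma eigenvalue_lambda l :
  eigenvalue endo l -> l = lambda_base t \/ l = lambda_fiber t.
Proof.
move=> /eigenvalueP[v /eigenvector_endo].
have [c [D [-> HD]]] := ricci_warped_block.
rewrite -[v]hsubmxK; set a := lsubmx v; set w := rsubmx v.
rewrite /warped_metric warped_point_base warped_point_fiber !mul_row_block.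
rewrite !mulmx0 !addr0 !add0r mulmx1 scale_row_mx => /eq_row_mx[ea ew] v0.
(* If the fiber component [w] vanishes, the base component gives [lambda_base]. Otherwise the fiber
   equation is paired with [w] itself, which brings in the quadratic form of [D]. *)
have [w0|w0] := eqVneq w 0; [left|right].
  have a0 : a != 0 by apply: contraNneq v0 => ->; rewrite w0 row_mx0.
  move: ea; rewrite w0 mul0mx addr0 mul_mx_scalar => /eqP.
  rewrite -subr_eq0 -scalerBl scaler_eq0 (negbTE a0) orbF subr_eq0.
  by move=> /eqP.
have : bil D w w = l * (f t ^+ 2 * bil (h x) w w).
  by rewrite /bil ew -scalemxAr -!scalemxAl !mxE.
rewrite HD -mulrA => /mulIf ->//.
by rewrite mulf_neq0 ?expf_neq0 ?warping_neq0 // gt_eqF ?fiber_metric_pos.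
Qed.
End Point.

(** * Pinching and definiteness along a phase *)

Lemma pinching_lambda t p C : J t -> 1 < C ->
  (0 < lambda_base t /\ 0 < lambda_fiber t) \/ (lambda_base t < 0 /\ lambda_fiber t < 0) ->
  ricci_pinching W (t, p) = C^-1 ->
  lambda_fiber t = C * lambda_base t \/ lambda_base t = C * lambda_fiber t.
Proof.
move=> Jt C1 signs; rewrite /ricci_pinching; set N := (X in inf X) => HN.
have Nbase : N `|lambda_base t|.
  have [i ip] := rm_cover gF_riem p.
  exists (lambda_base t) => //; exists i; first by split.
  exact: (eigenvalue_base _ _ _ Jt ip).
have sN : N `<=` [set `|lambda_base t|; `|lambda_fiber t|].
  move=> _ [l [i [/= _ ip] il] <-].
  by have [->|->] := eigenvalue_lambda _ _ _ Jt ip _ il; [left|right].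
have : `|lambda_fiber t| = C * `|lambda_base t| \/ `|lambda_base t| = C * `|lambda_fiber t|.
  have nz : lambda_base t != 0 /\ lambda_fiber t != 0.
    by case: signs => -[a b]; rewrite ?(gt_eqF a) ?(gt_eqF b) ?(lt_eqF a) ?(lt_eqF b).
  by apply: (inf_sup_pinching N) HN; rewrite ?normr_gt0 //; case: nz.
case: signs => -[a b]; first by rewrite !gtr0_norm.
by rewrite !ltr0_norm // !mulrN => -[] /oppr_inj; [left|right].
Qed.

(** Vanishing of [lambda_base] gives f'' = 0; then [lambda_fiber] reduces to a nonzero multiple of
    the defect, as m > 1. *)
Lemma ricci_flat_defect t : J t -> ricci_flat_at J f gF t ->
  defect f kappa t = 0.
Proof.
move=> Jt flat; have [p _] := rm_nonempty gF_riem.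
have [i ip] := rm_cover gF_riem p.
have [] := flat_lambda _ _ _ Jt ip (flat i (t, p) (conj erefl Logic.I) (conj Jt ip)).
have f0 := gt_eqF (fpos _ Jt).
have m0 : m%:R != 0 :> R by rewrite pnatr_eq0 -lt0n ltnW.
have m1 : m%:R - 1 != 0 :> R.
  by rewrite -[1]/(1%:R) -natrB ?(ltnW m2) // pnatr_eq0 subn_eq0 -ltnNge.
move=> /eqP; rewrite /lambda_base !mulf_eq0 invr_eq0 oppr_eq0 (negbTE m0) f0 orbF /= => /eqP e2.
rewrite /lambda_fiber e2 oppr0 mul0r add0r => /eqP.
by rewrite !mulf_eq0 invr_eq0 expf_eq0 f0 /= orbF (negbTE m1) => /eqP.
Qed.

(** Both lambdas depend on [t] alone, so one fiber point and one chart around it suffice. *)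
Lemma definite_phase_lambda I : definite_ricci_phase J f gF I ->
  (forall t, I t -> 0 < lambda_base t /\ 0 < lambda_fiber t) \/
  (forall t, I t -> lambda_base t < 0 /\ lambda_fiber t < 0).
Proof.
move=> [_ IJ]; have [p _] := rm_nonempty gF_riem.
have [i ip] := rm_cover gF_riem p.
case=> def; [left|right] => t It.
  exact: (posdef_lambda _ _ _ (IJ _ It) ip (def i (t, p) (conj It Logic.I) (conj (IJ _ It) ip))).
exact: (negdef_lambda _ _ _ (IJ _ It) ip (def i (t, p) (conj It Logic.I) (conj (IJ _ It) ip))).
Qed.

(** Regularity required by [nonvanishing_sign]; f'' is differentiated once more. *)
Lemma derivable_lambda t : J t ->
  derivable (fun s => lambda_fiber s - lambda_base s) t 1.
Proof.
move=> Jt.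
have df : derivable f t 1 := fsmooth 0 _ Jt.
have df2 : derivable f2 t 1 := fsmooth 2 _ Jt.
have [dw _] := is_derive_defect J f kappa fsmooth _ Jt.
have f0 : f t != 0 by rewrite gt_eqF ?fpos.
have f20 : (f ^+ 2) t != 0 by exact: (expf_neq0 2 f0).
have df' := derivableV f0 df.
have dm (a : R) : derivable (cst a) t 1 := derivable_cst a t 1.
have d2 := derivableV f20 (@derivableX _ _ f 2 t 1 df).
exact: (derivableB
  (derivableD (derivableM (derivableN df2) df')
     (derivableM (derivableM (dm (m%:R - 1)) dw) d2))
  (derivableM (derivableM (dm (- m%:R)) df2) df')).
Qed.

Lemma no_bad_phase (C : R) (I : set R) (t0 : R) :
  definite_ricci_phase J f gF I -> m%:R <= C ->
  has_exact_pinching J f gF I C^-1 -> (closure I `&` J) t0 ->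
  ricci_flat_at J f gF t0 -> False.
Proof.
move=> phase mC pin [clI Jt0] /(ricci_flat_defect _ Jt0) w0.
have lam := definite_phase_lambda _ phase.
case: phase => -[Ine Iopen Iint] IJ _.
have [p _] := rm_nonempty gF_riem.
have m2R : 2 <= m%:R :> R by rewrite (ler_nat _ 2).
have C1 : 1 < C by lra.
have two t : I t -> lambda_fiber t = C * lambda_base t \/ lambda_base t = C * lambda_fiber t.
  move=> It; apply: pinching_lambda (pin (t, p) (conj It Logic.I)) => //; first exact: IJ.
  by case: lam => /(_ _ It); [left|right].
have f20 t : I t -> f2 t != 0.
  move=> It; apply: contraPneq lam => e2.
  by case=> /(_ _ It)[]; rewrite /lambda_base e2 mulr0 mul0r ltxx.
have fI t : I t -> f t != 0 by move=> /IJ/fpos; rewrite lt0r => /andP[].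
have flatten c : (forall t, I t -> f t * f2 t = c * defect f kappa t) -> False.
  case: Ine => t It ode; have /eqP := f20 _ It; apply.
  exact: (defect_rigidity _ _ _ _ Iint IJ fsmooth fpos _ _ clI Jt0 w0 ode).
have base_ode : (forall t, I t -> lambda_fiber t = C * lambda_base t) -> False.
  move=> eqn; have Cm : C * m%:R - 1 != 0 by rewrite gt_eqF //; nra.
  (* Multiplying [lambda_fiber] = C [lambda_base] by f^2 gives (C m - 1) f f'' = -(m - 1) w, with w
     the defect; this constant is the resulting quotient. *)
  apply: (flatten (- (m%:R - 1) / (C * m%:R - 1))) => t It.
  have E : (lambda_fiber t - C * lambda_base t) * f t ^+ 2 =
      (C * m%:R - 1) * (f t * f2 t) + (m%:R - 1) * defect f kappa t.
    rewrite /lambda_fiber /lambda_base.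
    by move: (f t) (f2 t) (defect f kappa t) (fI _ It) => y y2 w y0; field.
  move: E; rewrite eqn // subrr mul0r => /esym/eqP; rewrite addr_eq0 => /eqP E.
  by apply: (mulfI Cm); rewrite E mulrA [_ * (_ / _)]mulrC mulfVK // mulNr.
have fiber_ode : (forall t, I t -> lambda_base t = C * lambda_fiber t) -> False.
  move=> eqn.
  have E t : I t -> (C - m%:R) * (f t * f2 t) = C * (m%:R - 1) * defect f kappa t.
    move=> It; apply/eqP; rewrite -subr_eq0.
    have -> : (C - m%:R) * (f t * f2 t) - C * (m%:R - 1) * defect f kappa t =
        (lambda_base t - C * lambda_fiber t) * f t ^+ 2.
      rewrite /lambda_fiber /lambda_base.
      by move: (f t) (f2 t) (defect f kappa t) (fI _ It) => y y2 w y0; field.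
    by rewrite eqn // subrr mul0r.
  (* At C = m the relation [E] cannot be solved for f'', but it forces the defect to vanish. *)
  have [Cm|Cm] := eqVneq (C - m%:R) 0.
    apply: (defect0_empty _ _ _ kappa Iopen IJ fsmooth _ f20 Ine) => t It.
    move: (E _ It); rewrite Cm mul0r => /esym/eqP.
    have Cm1 : 0 < C * (m%:R - 1) by apply: mulr_gt0; lra.
    by rewrite mulf_eq0 (gt_eqF Cm1) => /eqP.
  apply: (flatten (C * (m%:R - 1) / (C - m%:R))) => t It.
  by apply: (mulfI Cm); rewrite E // mulrA [_ * (_ / _)]mulrC mulfVK.
(* Equal eigenvalues would satisfy l = C l with l nonzero and C > 1. *)
have diff0 t : I t -> lambda_fiber t - lambda_base t != 0.
  move=> It; apply/eqP => e.
  case: lam => /(_ _ It)[a b]; case: (two _ It); nra.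
(* The constant sign of the difference, combined with the sign of Ric, decides which eigenvalue has
   the larger absolute value. The same alternative of [two] therefore holds on all of [I]; for
   negative Ric the roles are swapped. *)
have [] := nonvanishing_sign _ _ Iint (fun t It => derivable_lambda _ (IJ _ It)) diff0 => sgn.
  case: lam => lam; [apply: base_ode|apply: fiber_ode] => t It;
    by have [] := two _ It => // e; have := sgn _ It; have [a b] := lam _ It; nra.
case: lam => lam; [apply: fiber_ode|apply: base_ode] => t It;
  by have [] := two _ It => // e; have := sgn _ It; have [a b] := lam _ It; nra.
Qed.
End WarpedPhase.

Theorem proposition7p2 (R : realType) (m : nat) (F : topologicalType)
    (gF : atlas R F m) (kappa : R) (J : set R) (f : R -> R) :
  (2 <= m)%N ->
  riemannian_manifold gF ->
  constant_sectional_curvature gF kappa ->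
  open_interval J ->
  smooth_fun_on J f ->
  (forall t, J t -> 0 < f t) ->
  let bad_phase (C : R) (I : set R) (t0 : R) :=
    [/\ definite_ricci_phase J f gF I,
        m%:R <= C,
        has_exact_pinching J f gF I C^-1,
        (closure I `&` J) t0
      & ricci_flat_at J f gF t0] in
  (forall C I t0, bad_phase C I t0 ->
     exists N : set R,
       [/\ one_sided_nbhd t0 N,
           N `<=` I,
           affine_on N f
         & ricci_flat_on (warped_product J f gF) (N `*` setT)]) /\
  ~ (exists C I t0, bad_phase C I t0).
Proof.
move=> m2 riem sec [_ Jopen _] fsmooth fpos bad_phase.
have no_bad C I t0 : ~ bad_phase C I t0.
  move=> [phase mC pin cl flat].
  exact: (no_bad_phase _ _ _ _ m2 riem sec Jopen fsmooth fpos _ _ _ phase mC pin cl flat).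
(* Both conclusions follow from nonexistence; the neighborhood [N] is obtained from the
   contradiction. *)
by split => [C I t0 /no_bad //|[C [I [t0 /no_bad]]]].
Qed.
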